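(* Let $\phi:\mathbb{R}^n\to\mathbb{R}$ be a reference function with $\operatorname{dom}\phi=\mathbb{R}^n$, and let $f\in\mathcal{C}^1(\mathbb{R}^n)$ be anisotropically smooth relative to $\phi$ with constant $L>0$ and satisfy $f_\star=\inf f>-\infty$. Suppose that $f$ satisfies the anisotropic gradient dominance condition relative to $\phi$ with constant $\mu>0$, and let $g$ be a stochastic first-order oracle such that $$\mathbb{E}\left[\phi\big(\nabla\phi^*(\nabla f(x))-\nabla\phi^*(g(x))\big)\right]\le\sigma^2\qquad\text{for all }x\in\mathbb{R}^n .$$ Let $x^0\in\mathbb{R}^n$ and let $\{x^k\}_{k\in\mathbb{N}_0}$ be generated by $x^{k+1}=x^k-\gamma\nabla\phi^*(g(x^k))$ with stepsize $0<\gamma\le\frac1L$. Then, for every $k\in\mathbb{N}_0$, $$\mathbb{E}[f(x^k)-f_\star]\le(1-\gamma\mu)^k(f(x^0)-f_\star)+\frac{\sigma^2}{\mu}.$$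
   Context: $\|\cdot\|$ is the Euclidean norm on $\mathbb{R}^n$; $\phi^*$ is the convex conjugate of $\phi$. Reference function (with full domain): $\phi:\mathbb{R}^n\to\mathbb{R}$ is strongly convex and even with $\phi(0)=0$, and $\phi\in\mathcal{C}^2(\mathbb{R}^n)$. (Then $\phi^*\in\mathcal{C}^2(\mathbb{R}^n)$.) Episcaling: for $\lambda>0$, $(\lambda\star\phi)(x)=\lambda\phi(\lambda^{-1}x)$. Anisotropic smoothness: $f\in\mathcal{C}^1(\mathbb{R}^n)$ is anisotropically smooth relative to $\phi$ with constant $L>0$ if for all $x,\bar x\in\mathbb{R}^n$ $$f(x)\le f(\bar x)+\left(\tfrac1L\star\phi\right)(x-\bar y)-\left(\tfrac1L\star\phi\right)(\bar x-\bar y),\qquad \bar y=\bar x-\tfrac1L\nabla\phi^*(\nabla f(\bar x)).$$ Anisotropic gradient dominance: $f$ satisfies it relative to $\phi$ with constant $\mu>0$ if for all $x\in\mathbb{R}^n$, $\phi(\nabla\phi^*(\nabla f(x)))\ge\mu(f(x)-f_\star)$. Stochastic oracle: when queried at a point $x$, it returns a random vector $g(x)\in\mathbb{R}^n$ (a stochastic gradient; no unbiasedness is assumed). The call at each iteration uses fresh randomness, so that conditionally on $x^k$ the vector $g(x^k)$ is distributed as the oracle's output at the point $x^k$; the initial point $x^0$ is deterministic. *)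

(* Defs.v *)
From HB Require Import structures.
From mathcomp Require Import all_boot all_order all_algebra.
From mathcomp Require Import all_classical all_reals all_analysis.

Set Implicit Arguments.
Unset Strict Implicit.
Unset Printing Implicit Defensive.

Import Order.TTheory GRing.Theory Num.Theory.
Import numFieldNormedType.Exports.

Local Open Scope classical_set_scope.
Local Open Scope ring_scope.

Section deterministic.
Context {R : realType} {n : nat}.
Implicit Types (f phi : 'rV[R]_n -> R) (x y u v : 'rV[R]_n).

Definition dotrv u v : R := \sum_(i < n) u 0 i * v 0 i.

(* The norm [`|x|] of the library on ['rV[R]_n] is the sup norm. *)
Definition enorm x : R := Num.sqrt (dotrv x x).

Definition grad f x : 'rV[R]_n := \row_(i < n) 'D_(delta_mx 0 i) f x.

(* Differentiability and continuity refer to the sup-norm topology, which is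
   the Euclidean one. *)
Definition C1 f : Prop := (forall x, differentiable f x) /\ continuous (grad f).

Definition C2 f : Prop := C1 f /\ forall i : 'I_n, C1 (fun x => grad f x 0 i).

Definition strongly_convex phi : Prop :=
  exists2 c : R, 0 < c & forall x y (t : R), 0 <= t <= 1 ->
    phi (t *: x + (1 - t) *: y) <=
    t * phi x + (1 - t) * phi y - c / 2 * t * (1 - t) * enorm (x - y) ^+ 2.

Definition reference_function phi : Prop :=
  [/\ strongly_convex phi, forall x, phi (- x) = phi x, phi 0 = 0 & C2 phi].

Definition conjugate phi y : \bar R :=
  ereal_sup (range (fun x => (dotrv x y - phi x)%:E)).

(* The conjugate of a strongly convex real-valued function is finite
   everywhere, so [fine] loses nothing for reference functions. *)
Definition grad_conj phi : 'rV[R]_n -> 'rV[R]_n := grad (fine \o conjugate phi).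

Definition episcale (lambda : R) phi x : R := lambda * phi (lambda^-1 *: x).

Definition anisotropically_smooth phi (L : R) f : Prop :=
  forall x xb, let yb := xb - L^-1 *: grad_conj phi (grad f xb) in
    f x <= f xb + episcale L^-1 phi (x - yb) - episcale L^-1 phi (xb - yb).

Definition anisotropic_gradient_dominance phi (mu : R) f : Prop :=
  forall x, mu * (f x - inf (range f)) <= phi (grad_conj phi (grad f x)).

End deterministic.

Definition borel_rV (R : realType) (n : nat) :=
  g_sigma_algebraType (@open 'rV[R]_n).

(* The conditional distribution of [Y] given [X] is [K X], where [K x B] is the
   probability that the oracle queried at [x] answers in [B]. *)
Definition conditional_law (R : realType) (d d1 d2 : measure_display)
    (T : measurableType d) (T1 : measurableType d1) (T2 : measurableType d2)
    (P : probability T R) (X : T -> T1) (Y : T -> T2) (K : R.-pker T1 ~> T2) :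
    Prop :=
  forall (A : set T1) (B : set T2), measurable A -> measurable B ->
    P (X @^-1` A `&` Y @^-1` B) = (\int[P]_(w in X @^-1` A) K (X w) B)%E.

(* Main.v *)
Require Import Defs.
From HB Require Import structures.
From mathcomp Require Import all_boot all_order all_algebra.
From mathcomp Require Import all_classical all_reals all_analysis.
From mathcomp Require Import measurable_realfun ring lra.
Import Order.TTheory GRing.Theory Num.Theory.
Import numFieldNormedType.Exports.
Local Open Scope classical_set_scope.
Local Open Scope ring_scope.

(* Write [u = grad_conj phi (grad f x)] and [v = grad_conj phi (g x)]. Anisotropic
   smoothness at [x - gamma v] and the convexity of [phi] give
   [f (x - gamma v) <= f x - gamma phi u + gamma phi (u - v)], hence, by gradient
   dominance, [f (x - gamma v) - inf f] is at most
   [(1 - gamma mu) (f x - inf f) + gamma phi (u - v)].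
   All terms are nonnegative, so this can be integrated without integrability
   assumptions, and disintegrating along the law of [g k] given [x k] bounds the
   last term by [gamma sigma^2]; the recursion sums to a geometric series.
   The iterates are measurable because [grad_conj phi y] is the unique maximizer
   of [x |-> <x, y> - phi x], which is Lipschitz in [y] by strong convexity. *)

(** * Algebra and continuity of the Euclidean inner product *)

Section dot_product.
Context {R : realType} {n : nat}.
Implicit Types u v w : 'rV[R]_n.

Lemma dotrvC u v : dotrv u v = dotrv v u.
Proof. by apply: eq_bigr => i _; rewrite mulrC. Qed.

Lemma dotrvDl u v w : dotrv (u + v) w = dotrv u w + dotrv v w.
Proof. by rewrite -big_split; apply: eq_bigr => i _; rewrite mxE mulrDl. Qed.

Lemma dotrvZl a u w : dotrv (a *: u) w = a * dotrv u w.
Proof. by rewrite /dotrv mulr_sumr; apply: eq_bigr => i _; rewrite mxE mulrA. Qed.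

Lemma dotrvDr u v w : dotrv w (u + v) = dotrv w u + dotrv w v.
Proof. by rewrite dotrvC dotrvDl !(dotrvC _ w). Qed.

Lemma dotrvZr a u w : dotrv w (a *: u) = a * dotrv w u.
Proof. by rewrite dotrvC dotrvZl (dotrvC _ w). Qed.

Lemma dotrvBl u v w : dotrv (u - v) w = dotrv u w - dotrv v w.
Proof. by rewrite dotrvDl -scaleN1r dotrvZl mulN1r. Qed.

Lemma dotrvBr u v w : dotrv w (u - v) = dotrv w u - dotrv w v.
Proof. by rewrite dotrvC dotrvBl !(dotrvC _ w). Qed.

Lemma dotrv0 u : dotrv 0 u = 0.
Proof. by apply: big1 => i _; rewrite mxE mul0r. Qed.

Lemma dotrv_delta u i : dotrv u (delta_mx 0 i) = u 0 i.
Proof.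
rewrite /dotrv (bigD1 i)//= mxE !eqxx mulr1 big1 ?addr0// => j ji.
by rewrite mxE eqxx (negbTE ji) mulr0.
Qed.

Lemma dotrv_ge0 u : 0 <= dotrv u u.
Proof. by apply: sumr_ge0 => i _; rewrite -expr2 sqr_ge0. Qed.

Lemma enorm_sqr u : enorm u ^+ 2 = dotrv u u.
Proof. by rewrite sqr_sqrtr// dotrv_ge0. Qed.

Lemma sqr_coord_le u i : (u 0 i) ^+ 2 <= dotrv u u.
Proof.
rewrite /dotrv (bigD1 i)//= -expr2 lerDl.
by apply: sumr_ge0 => j _; rewrite -expr2 sqr_ge0.
Qed.

(** Expand the nonnegative square of [u - (2 / c) *: v], scaled by [c / 4]. This weight is small
    enough to be absorbed by the quadratic terms that strong convexity supplies below. *)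
Lemma dotrv_young c u v : 0 < c ->
  dotrv u v <= c / 4 * dotrv u u + dotrv v v / c.
Proof.
move=> c0; have c1 : c != 0 by rewrite gt_eqF.
have : 0 <= c / 4 * dotrv (u - (2 / c) *: v) (u - (2 / c) *: v).
  by rewrite mulr_ge0 ?dotrv_ge0// divr_ge0// ltW.
rewrite !(dotrvBl, dotrvBr, dotrvZl, dotrvZr) (dotrvC v u) => h.
rewrite -subr_ge0; apply: (le_trans h); rewrite le_eqVlt; apply/orP; left.
by apply/eqP; field.
Qed.

Lemma dotrv_continuous v : continuous (fun u => dotrv u v).
Proof.
apply: continuous_big => [|i _ u]; first exact: add_continuous.
apply: (@cvgMr_tmp _ _ _ (nbhs_filter u)).
exact: (@coord_continuous R 1 n 0 i u).
Qed.

Lemma dotrv_sqr_continuous : continuous (fun u => dotrv u u).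
Proof.
apply: continuous_big => [|i _ u]; first exact: add_continuous.
by apply: (@cvgM _ _ _ (nbhs_filter u)); exact: (@coord_continuous R 1 n 0 i u).
Qed.

End dot_product.

(** * Maximizers and gradient of the conjugate of a strongly convex function *)

Section conjugate_of_strongly_convex.
Context {R : realType} {n : nat} (phi : 'rV[R]_n -> R) (c : R).
Hypothesis c0 : 0 < c.
Hypothesis phi_sc : forall x y (t : R), 0 <= t <= 1 ->
  phi (t *: x + (1 - t) *: y) <=
  t * phi x + (1 - t) * phi y - c / 2 * t * (1 - t) * enorm (x - y) ^+ 2.

Lemma strongly_convex_midpoint x y :
  phi (2^-1 *: x + 2^-1 *: y) <=
  (phi x + phi y) / 2 - c / 8 * dotrv (x - y) (x - y).
Proof.
have h : 0 <= (2^-1 : R) <= 1 by apply/andP; split; lra.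
have := phi_sc x y 2^-1 h; rewrite enorm_sqr.
have -> : 1 - 2^-1 = 2^-1 :> R by lra.
by move=> /le_trans; apply; lra.
Qed.

(** The points [x] and [- x] have midpoint 0 and equal values, so the midpoint inequality at this
    pair is the claim. *)
Lemma even_strongly_convex_ge : (forall x, phi (- x) = phi x) -> phi 0 = 0 ->
  forall x, c / 2 * dotrv x x <= phi x.
Proof.
move=> phiN phi00 x; have := strongly_convex_midpoint x (- x).
have -> : 2^-1 *: x + 2^-1 *: - x = 0 by rewrite scalerN subrr.
rewrite phi00 phiN opprK dotrvDl !dotrvDr; lra.
Qed.

(** Equivalently, [y] is a subgradient of [phi] at [p]. *)
Definition conj_argmax (y p : 'rV[R]_n) :=
  forall x, dotrv x y - phi x <= dotrv p y - phi p.

(** The set where the objective is nonnegative contains 0 and is compact by the quadratic growth of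
    [phi]. A maximizer on it also beats the negative values outside. *)
Lemma conj_argmax_exists y : continuous phi ->
  (forall x, c / 2 * dotrv x x <= phi x) -> phi 0 = 0 ->
  exists p, conj_argmax y p.
Proof.
move=> cphi phi_ge phi00.
pose h x := dotrv x y - phi x.
have ch : continuous h.
  move=> x; apply: (@cvgB _ _ _ _ (nbhs_filter x)); last exact: (cphi x).
  exact: (dotrv_continuous y x).
pose A := [set x | 0 <= h x].
have cA : compact A.
  apply: bounded_closed_compact; last first.
    by apply: (@closed_comp _ _ h [set r | 0 <= r]) => //; exact: closed_ge.
  (* On [A], Young's inequality leaves [c / 4 * dotrv x x <= dotrv y y / c], so [M] bounds the
     squared norm. Then [M + 1] bounds each coordinate without a square root, since [a ^+ 2 <= M]
     forces [a <= M + 1]. *)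
  pose M := 4 / c ^+ 2 * dotrv y y.
  exists (M + 1); split; first by rewrite num_real.
  move=> r Mr x Ax.
  have xM : dotrv x x <= M.
    have : 0 <= dotrv x y - c / 2 * dotrv x x.
      by apply: (le_trans Ax); rewrite lerB// phi_ge.
    have := dotrv_young c x y c0 => h1 h2.
    have h3 : c / 4 * dotrv x x <= dotrv y y / c by lra.
    rewrite /M -(ler_pM2l (_ : 0 < c / 4)); last by rewrite divr_gt0.
    apply: (le_trans h3); rewrite le_eqVlt; apply/orP; left; apply/eqP.
    by field; rewrite gt_eqF.
  change (mx_norm x <= r); rewrite mx_normrE; apply/bigmax_leP; split.
    apply: ltW; apply: le_lt_trans Mr.
    by rewrite addr_ge0// (le_trans _ xM)// dotrv_ge0.
  move=> [i j] _ /=; rewrite ord1.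
  have := sqr_coord_le x j => h1.
  apply/ltW; apply: le_lt_trans Mr.
  rewrite -(real_normK (num_real _)) in h1.
  nra.
have A0 : A !=set0 by exists 0; rewrite /A/= /h dotrv0 phi00 subrr.
have [p Ap pmax] : exists2 p, p \in A & forall x, x \in A -> h x <= h p.
  by apply: compact_EVT_max => //; exact: continuous_subspaceT.
exists p => x; have [Ax|] := leP 0 (h x); first by apply: pmax; rewrite inE.
by move=> /ltW/le_trans; apply; rewrite inE in Ap.
Qed.

(** Compare [p] with the midpoint of [x] and [p]: the strong convexity gain [c / 8] there doubles to
    [c / 4]. *)
Lemma conj_argmax_quad y p : conj_argmax y p ->
  forall x, dotrv x y - phi x <=
            dotrv p y - phi p - c / 4 * dotrv (x - p) (x - p).
Proof.
move=> pmax x; have := pmax (2^-1 *: x + 2^-1 *: p).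
have := strongly_convex_midpoint x p.
rewrite (dotrvDl (2^-1 *: x)) !dotrvZl; lra.
Qed.

Lemma conj_argmaxE y p : conj_argmax y p ->
  conjugate phi y = (dotrv p y - phi p)%:E.
Proof.
move=> pmax; apply/eqP; rewrite eq_le; apply/andP; split.
  by apply: ge_ereal_sup => _ [x _ <-]; rewrite lee_fin pmax.
by apply: ereal_sup_ubound; exists p.
Qed.

(** Adding the quadratic bounds of both maximizers, each tested at the other, bounds [c / 2] times
    the squared distance by [dotrv (p' - p) (y' - y)]; Young's inequality absorbs half of it. *)
Lemma conj_argmax_lipschitz y y' p p' : conj_argmax y p -> conj_argmax y' p' ->
  dotrv (p' - p) (p' - p) <= 4 / c ^+ 2 * dotrv (y' - y) (y' - y).
Proof.
move=> hp hp'.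
have := conj_argmax_quad _ _ hp p'; have := conj_argmax_quad _ _ hp' p.
have := dotrv_young c (p' - p) (y' - y) c0.
have -> : dotrv (p - p') (p - p') = dotrv (p' - p) (p' - p).
  rewrite -(opprB p' p) -[- (p' - p)]scaleN1r dotrvZl dotrvZr.
  by rewrite !mulN1r opprK.
rewrite [dotrv (p' - p) (y' - y)]dotrvBr ![dotrv (p' - p) y]dotrvBl.
rewrite [dotrv (p' - p) y']dotrvBl => h1 h2 h3.
have h : c / 4 * dotrv (p' - p) (p' - p) <= dotrv (y' - y) (y' - y) / c by lra.
rewrite -(ler_pM2l (_ : 0 < c / 4)); last by rewrite divr_gt0.
apply: (le_trans h); rewrite le_eqVlt; apply/orP; left; apply/eqP.
by field; rewrite gt_eqF.
Qed.

Hypothesis argmax_exists : forall y, exists p, conj_argmax y p.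

(** Below, [p] competes in the supremum at [h *: v + y]. Above, the maximizer [q] there is tested at
    [y], and the quadratic loss in [q - p] pays for replacing [q] by [p] in the linear term. *)
Lemma conjugate_increment y p v (h : R) : conj_argmax y p ->
  h * dotrv p v <=
    fine (conjugate phi (h *: v + y)) - fine (conjugate phi y) <=
  h * dotrv p v + h ^+ 2 * (dotrv v v / c).
Proof.
move=> hp; have [q hq] := argmax_exists (h *: v + y).
rewrite (conj_argmaxE _ _ hp) (conj_argmaxE _ _ hq)/=; apply/andP; split.
  by have := hq p; rewrite !dotrvDr !dotrvZr; lra.
have := conj_argmax_quad _ _ hp q.
have := dotrv_young c (q - p) (h *: v) c0.
rewrite !dotrvDr !dotrvZr !dotrvZl dotrvBl; lra.
Qed.

(** An envelope argument: divided by [h], the increment is squeezed to the slope of the affine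
    function active at [y]. *)
Lemma derive_conjugate y p v : conj_argmax y p ->
  'D_v (fine \o conjugate phi) y = dotrv p v.
Proof.
move=> hp; apply/cvg_lim => //.
have h0 : (fun h : R => dotrv p v + `|h| * (dotrv v v / c)) @ 0^' --> dotrv p v.
  rewrite -[X in _ --> X]addr0 -[X in _ + X](mul0r (dotrv v v / c)).
  apply: cvgD; first exact: cvg_cst.
  apply: cvgMr_tmp; rewrite -[X in _ --> X](@normr0 R R).
  apply: cvg_norm; exact: nbhs_dnbhs.
have h1 : (fun h : R => dotrv p v - `|h| * (dotrv v v / c)) @ 0^' --> dotrv p v.
  rewrite -[X in _ --> X]subr0 -[X in _ - X](mul0r (dotrv v v / c)).
  apply: cvgB; first exact: cvg_cst.
  apply: cvgMr_tmp; rewrite -[X in _ --> X](@normr0 R R).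
  apply: cvg_norm; exact: nbhs_dnbhs.
apply: (squeeze_cvgr _ h1 h0); near=> h.
have hn0 : h != 0 by near: h; exact: nbhs_dnbhs_neq.
have V0 : 0 <= dotrv v v / c by rewrite divr_ge0 ?dotrv_ge0 ?ltW.
have /andP[] := conjugate_increment _ _ v h hp.
rewrite /= /GRing.scale/=.
set D := fine _ - fine _ => l u.
(* Dividing by a negative [h] reverses the bounds; the envelope, symmetric in [h], covers both
   signs. *)
have [hp0|hm0|/eqP] := ltgtP h 0; last by rewrite (negbTE hn0).
  rewrite ltr0_norm// ![h^-1 * _]mulrC.
  rewrite ler_ndivlMr// ler_ndivrMr//.
  apply/andP; split; nra.
rewrite gtr0_norm// ![h^-1 * _]mulrC.
rewrite ler_pdivlMr// ler_pdivrMr//.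
apply/andP; split; nra.
Unshelve. all: by end_near. Qed.

Lemma grad_conjE y p : conj_argmax y p -> grad_conj phi y = p.
Proof.
move=> hp; apply/rowP => i.
by rewrite mxE (derive_conjugate _ _ _ hp) dotrv_delta.
Qed.

Lemma grad_conj_coord_continuous i : continuous (fun y => grad_conj phi y 0 i).
Proof.
move=> y; apply/(@cvgrPdist_lt _ _ _ _ (nbhs_filter y)) => e e0.
have cN : (fun y' => 4 / c ^+ 2 * dotrv (y - y') (y - y')) @ nbhs y --> 0.
  rewrite -[X in _ --> X](mulr0 (4 / c ^+ 2)).
  apply: (@cvgMl_tmp _ _ _ (nbhs_filter y)).
  rewrite -(dotrv0 (y - y)) -{1}(subrr y).
  apply: (cvg_comp (fun y' => y - y') (fun u => dotrv u u)); last first.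
    exact: dotrv_sqr_continuous.
  by apply: (@cvgB _ _ _ _ (nbhs_filter y)); [exact: cvg_cst|exact: cvg_id].
near=> y'.
have [p hp] := argmax_exists y; have [p' hp'] := argmax_exists y'.
rewrite (grad_conjE _ _ hp) (grad_conjE _ _ hp').
have lt_e : 4 / c ^+ 2 * dotrv (y - y') (y - y') < e ^+ 2.
  near: y'; apply: (@cvgr_lt _ _ _ (nbhs_filter y) _ _ cN); exact: exprn_gt0.
have := conj_argmax_lipschitz _ _ _ _ hp' hp.
have := sqr_coord_le (p - p') i; rewrite !mxE => h1 h2.
rewrite -(@ltr_pXn2r _ 2%N isT) ?nnegrE ?normr_ge0 ?(ltW e0)//.
by rewrite real_normK ?num_real//; lra.
Unshelve. all: by end_near. Qed.

End conjugate_of_strongly_convex.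

(** * Measurability for the Borel sigma-algebra on row vectors *)

Section borel_row_vectors.
Context {R : realType} {n : nat}.

Lemma continuous_measurable_borel_rV (h : 'rV[R]_n -> R) :
  continuous h -> measurable_fun setT (h : borel_rV R n -> R).
Proof.
move=> /continuousP ch; apply: (measurability _ (RGenOpens.measurableE R)).
move=> _ [_ [a [b ->]] <-]; rewrite setTI.
apply: sub_sigma_algebra; apply: ch; exact: interval_open.
Qed.

Lemma measurable_coord_borel_rV (i : 'I_n) :
  measurable_fun setT (fun x : borel_rV R n => x 0 i).
Proof. by apply: continuous_measurable_borel_rV; exact: coord_continuous. Qed.

(** An open set is the union of the countably many rational open boxes it contains, and the preimage
    of a box is a finite intersection of coordinate conditions. *)
Lemma measurable_borel_rV d (T : measurableType d) (F : T -> borel_rV R n) :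
  (forall i, measurable_fun setT (fun w => F w 0 i)) -> measurable_fun setT F.
Proof.
move=> mF.
apply: (@measurability _ _ T (borel_rV R n) setT F (@open 'rV[R]_n)) => //.
move=> _ [U oU <-]; rewrite setTI.
pose box (q : 'rV[rat]_n * 'rV[rat]_n) :=
  [set x : 'rV[R]_n | forall i, x 0 i \in `]ratr (q.1 0 i), ratr (q.2 0 i)[].
have -> : F @^-1` U = \bigcup_q [set w | box q `<=` U /\ box q (F w)].
  apply/seteqP; split=> [w Uw|w [q _ [qU]]]; last exact: qU.
  have [e /= e0 eU] : exists2 e : R, 0 < e & ball (F w : 'rV[R]_n) e `<=` U.
    by apply/nbhs_ballP; apply: open_nbhs_nbhs.
  (* Rational endpoints within [e] on either side of each coordinate give a box around [F w] inside
     the sup-norm ball. *)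
  have /choice[a aP] (i : 'I_n) :
      exists a, (ratr a : R) \in `](F w 0 i - e), (F w 0 i)[.
    by apply: rat_in_itvoo; rewrite ltrBlDr ltrDl.
  have /choice[b bP] (i : 'I_n) :
      exists b, (ratr b : R) \in `](F w 0 i), (F w 0 i + e)[.
    by apply: rat_in_itvoo; rewrite ltrDl.
  exists (\row_i a i, \row_i b i) => //; split.
    move=> x bx; apply: eU; split => // i j; rewrite ord1.
    have := bx j; have := aP j; have := bP j.
    rewrite !mxE !in_itv/= => /andP[_ b2] /andP[a1 _] /andP[x1 x2].
    by rewrite /ball/= ltr_norml; apply/andP; split; lra.
  move=> i; have := aP i; have := bP i.
  by rewrite !mxE !in_itv/= => /andP[b1 _] /andP[_ a2]; rewrite a2 b1.
apply: countable_bigcupT_measurable => [|q]; first exact: countableP.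
have [qU|nqU] := pselect (box q `<=` U); last first.
  by rewrite (_ : [set _ | _] = set0)// -subset0 => w [].
rewrite (_ : [set _ | _] = \bigcap_(i in [set: 'I_n])
   ((fun w => F w 0 i) @^-1` [set` `]ratr (q.1 0 i), ratr (q.2 0 i)[])).
  apply: fin_bigcap_measurable => // i _.
  by rewrite -[X in measurable X]setTI; apply: mF.
by apply/seteqP; split=> [w [_ bw] i _|w bw]; [exact: bw|split=> // i; exact: bw].
Qed.

Lemma measurable_borel_rVB d (T : measurableType d) (F G : T -> 'rV[R]_n) :
  measurable_fun setT (F : T -> borel_rV R n) ->
  measurable_fun setT (G : T -> borel_rV R n) ->
  measurable_fun setT ((fun w => F w - G w) : T -> borel_rV R n).
Proof.
move=> mF mG; apply: measurable_borel_rV => i.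
under eq_fun do rewrite !mxE.
apply: measurable_funB.
  exact: (measurableT_comp (measurable_coord_borel_rV i) mF).
exact: (measurableT_comp (measurable_coord_borel_rV i) mG).
Qed.

Lemma measurable_borel_rVZ d (T : measurableType d) (a : R) (F : T -> 'rV[R]_n) :
  measurable_fun setT (F : T -> borel_rV R n) ->
  measurable_fun setT ((fun w => a *: F w) : T -> borel_rV R n).
Proof.
move=> mF; apply: measurable_borel_rV => i.
under eq_fun do rewrite !mxE.
apply: measurable_funM; first exact: measurable_cst.
exact: (measurableT_comp (measurable_coord_borel_rV i) mF).
Qed.

End borel_row_vectors.

(** * Disintegration of an integral along a conditional law *)

Definition pushforward_measure {R : realType} {d1 d2 : measure_display}
    {T1 : measurableType d1} {T2 : measurableType d2}
    (m : {measure set T1 -> \bar R}) {f : T1 -> T2}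
    (mf : measurable_fun setT f) : {measure set T2 -> \bar R}.
Proof. by refine (pushforward m f); exact: mf. Defined.

Section conditional_law_integral.
Local Open Scope ereal_scope.
Context {R : realType} {d d1 d2 : measure_display} {T : measurableType d}
  {T1 : measurableType d1} {T2 : measurableType d2}
  (P : probability T R) (X : T -> T1) (Y : T -> T2) (K : R.-pker T1 ~> T2).
Hypotheses (mX : measurable_fun setT X) (mY : measurable_fun setT Y).

Let const_law (_ : unit) : {measure set T -> \bar R} := P.

Let measurable_const_law U : measurable U ->
  measurable_fun [set: unit] (const_law ^~ U).
Proof. by move=> _; exact: measurable_cst. Qed.

HB.instance Definition _ :=
  isKernel.Build _ _ _ _ _ const_law measurable_const_law.

Let const_law_prob u : const_law u setT = 1.
Proof. exact: probability_setT. Qed.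

HB.instance Definition _ :=
  Kernel_isProbability.Build _ _ _ _ _ const_law const_law_prob.

Let measurable_pair_X w : measurable_fun setT (pair (X w) : T2 -> T1 * T2).
Proof.
by apply: measurable_fun_pair; [exact: measurable_cst|exact: measurable_id].
Qed.

(** The product of the Dirac mass at [X uw.2] with [K (X uw.2)], obtained as an image measure. *)
Let joint (uw : unit * T) : {measure set (T1 * T2) -> \bar R} :=
  pushforward_measure (K (X uw.2)) (measurable_pair_X uw.2).

Let measurable_joint U : measurable U ->
  measurable_fun [set: unit * T] (joint ^~ U).
Proof.
move=> mU; rewrite /joint /= /pushforward.
(* The [K z]-mass of the section of [U] at [z] is measurable in [z] because [K] is a finite
   kernel. *)
have -> : (fun uw : unit * T => K (X uw.2) (pair (X uw.2) @^-1` U)) =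
    (fun z => K z (xsection U z)) \o X \o snd.
  by apply/funext => uw /=; rewrite xsectionE.
apply: measurableT_comp; last exact: measurable_snd.
apply: measurableT_comp => //.
by apply: measurable_fun_xsection_finite_kernel; rewrite inE.
Qed.

HB.instance Definition _ :=
  isKernel.Build _ _ _ _ _ joint measurable_joint.

Let joint_prob uw : joint uw setT = 1.
Proof. exact: prob_kernel. Qed.

HB.instance Definition _ :=
  Kernel_isProbability.Build _ _ _ _ _ joint joint_prob.

(* [kcomp const_law joint tt] is the law of [(X, V)] where [V] has law [K X]
   given [X]; the parameter space [unit] only serves to reuse [integral_kcomp]. *)
Lemma conditional_law_integral (f : T1 * T2 -> \bar R) :
  conditional_law P X Y K -> measurable_fun setT f -> (forall z, 0 <= f z) ->
  \int[P]_w f (X w, Y w) = \int[P]_w \int[K (X w)]_v f (X w, v).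
Proof.
move=> XYK mf f0.
have mXY : measurable_fun setT (fun w => (X w, Y w)).
  exact: measurable_fun_pair.
have -> : \int[P]_w f (X w, Y w) =
    \int[pushforward P (fun w => (X w, Y w))]_z f z.
  by rewrite ge0_integral_pushforward.
pose m1 : {measure set (T1 * T2) -> \bar R} :=
  pushforward_measure P mXY.
pose m2 : {measure set (T1 * T2) -> \bar R} := kcomp const_law joint tt.
(* [conditional_law] compares the two laws on rectangles only; these generate the product
   sigma-algebra and are stable under intersection, and [m1] is finite. *)
have m12 A : measurable A -> m1 A = m2 A.
  apply: (measure_unique
    [set A `*` B | A in @measurable _ T1 & B in @measurable _ T2] (fun=> setT)).
  - exact: measurable_prod_measurableType.
  - move=> _ _ [A1 mA1 [B1 mB1 <-]] [A2 mA2 [B2 mB2 <-]].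
    by exists (A1 `&` A2); [exact: measurableI|exists (B1 `&` B2);
      [exact: measurableI|rewrite setXI]].
  - by move=> _; exists setT => //; exists setT => //; rewrite setXTT.
  - by rewrite bigcup_const//; exists 0%N.
  - move=> _ [B1 mB1 [B2 mB2 <-]].
    rewrite /m1 /m2 /= /pushforward /kcomp /= XYK// integral_mkcond.
    apply: eq_integral => w _; rewrite /joint /= /pushforward patchE.
    case: ifPn => [/set_mem Xw|/negP Xw].
      by congr (K _ _); apply/seteqP; split=> v //= [].
    rewrite (_ : _ @^-1` _ = set0) ?measure0//.
    by apply/seteqP; split=> v //= [Xw' _]; apply: Xw; rewrite inE.
  - by move=> _; rewrite /m1 /= /pushforward preimage_setT probability_setT ltry.
transitivity (\int[m2]_z f z).
  by apply: eq_measure_integral => A mA _; exact: m12.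
rewrite /m2 /= integral_kcomp//; apply: eq_integral => w _.
by rewrite /joint /= ge0_integral_pushforward//; exact: measurable_fun_pair.
Qed.

End conditional_law_integral.

(** * Reference functions and the one-step descent inequality *)

Section reference_function_theory.
Context {R : realType} {n : nat} (phi : 'rV[R]_n -> R).
Hypothesis phi_ref : reference_function phi.

Lemma reference_function_continuous : continuous phi.
Proof.
by case: phi_ref => _ _ _ [[dphi _] _] x; apply: differentiable_continuous.
Qed.

Lemma reference_function_ge0 x : 0 <= phi x.
Proof.
case: phi_ref => -[c c0 sc] phiN phi00 _.
apply: le_trans (even_strongly_convex_ge phi c sc phiN phi00 x).
by rewrite mulr_ge0 ?dotrv_ge0// divr_ge0// ltW.
Qed.

Lemma reference_function_convex x y (t : R) : 0 <= t <= 1 ->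
  phi (t *: x + (1 - t) *: y) <= t * phi x + (1 - t) * phi y.
Proof.
case: phi_ref => -[c c0 sc] _ _ _ t01; apply: (le_trans (sc x y t t01)).
case/andP: t01 => t0 t1; rewrite gerBl enorm_sqr.
by rewrite !mulr_ge0 ?dotrv_ge0 ?subr_ge0 ?invr_ge0 ?(ltW c0).
Qed.

Lemma measurable_grad_conj :
  measurable_fun setT (grad_conj phi : borel_rV R n -> borel_rV R n).
Proof.
case: (phi_ref) => -[c c0 sc] phiN phi00 _.
apply: measurable_borel_rV => i; apply: continuous_measurable_borel_rV.
apply: (grad_conj_coord_continuous phi c c0 sc) => y.
apply: (conj_argmax_exists phi c c0) => //.
- exact: reference_function_continuous.
- exact: (even_strongly_convex_ge phi c sc).
Qed.

(* A step [gamma <= 1 / L] moves only a fraction [gamma * L] of the way, and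
   convexity interpolates between [grad_conj phi (grad f x)] and the error. *)
Lemma anisotropic_descent f L gamma x v :
  0 < L -> 0 < gamma <= L^-1 -> anisotropically_smooth phi L f ->
  f (x - gamma *: v) <= f x - gamma * phi (grad_conj phi (grad f x)) +
    gamma * phi (grad_conj phi (grad f x) - v).
Proof.
move=> L0 /andP[g0 gL] /(_ (x - gamma *: v) x) /=.
set u := grad_conj phi (grad f x); rewrite /episcale invrK.
have L1 : L != 0 by rewrite gt_eqF.
have -> : L *: (x - (x - L^-1 *: u)) = u.
  by rewrite opprB addrC subrK scalerA divff// scale1r.
have -> : L *: (x - gamma *: v - (x - L^-1 *: u)) =
    (L * gamma) *: (u - v) + (1 - L * gamma) *: u.
  apply/rowP => i; rewrite !mxE; field.
  exact: L1.
have t01 : 0 <= L * gamma <= 1.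
  apply/andP; split; first by rewrite mulr_ge0 ?ltW.
  by rewrite mulrC -ler_pdivlMr ?div1r.
move=> /le_trans; apply.
(* Scaled by [L^-1], the weights become [gamma] and [L^-1 - gamma]; subtracting [L^-1 * phi u]
   leaves [- gamma * phi u]. *)
have := reference_function_convex (u - v) u (L * gamma) t01.
rewrite -(ler_pM2l (_ : 0 < L^-1)) ?invr_gt0//.
rewrite mulrDr !mulrA mulVf// mul1r mulrBr mulr1 mulrA mulVf// mul1r.
lra.
Qed.

End reference_function_theory.

Theorem theorem3p5 (R : realType) (n : nat)
    (phi f : 'rV[R]_n -> R) (L mu sigma gamma : R)
    (oracle : R.-pker (borel_rV R n) ~> (borel_rV R n))
    (d : measure_display) (T : measurableType d) (P : probability T R)
    (x0 : 'rV[R]_n) (x : nat -> T -> borel_rV R n)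
    (g : nat -> {RV P >-> borel_rV R n}) :
  reference_function phi ->
  C1 f ->
  0 < L -> anisotropically_smooth phi L f ->
  has_lbound (range f) ->
  0 < mu -> anisotropic_gradient_dominance phi mu f ->
  (forall z : 'rV[R]_n,
    (\int[oracle z]_v
       (phi (grad_conj phi (grad f z) - grad_conj phi v))%:E
     <= (sigma ^+ 2)%:E)%E) ->
  0 < gamma <= L^-1 ->
  (forall w, x 0%N w = x0) ->
  (forall k, conditional_law P (x k) (g k) oracle) ->
  (forall k w, x k.+1 w = x k w - gamma *: grad_conj phi (g k w) :> 'rV[R]_n) ->
  forall k : nat,
    ('E_P[fun w => (f (x k w) - inf (range f))%R]
     <= ((1 - gamma * mu) ^+ k * (f x0 - inf (range f)) + sigma ^+ 2 / mu)%:E)%E.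
Proof.

move=> phi_ref f1 L0 f_smooth f_lb mu0 f_dom oracle_le gammaL x0E xgK xS.
set fs := inf (range f).
have f_ge z : 0 <= f z - fs.
  by rewrite subr_ge0; apply: ge_inf => //; exists z.
have phi_ge0 := reference_function_ge0 _ phi_ref.
have gamma0 : 0 < gamma by case/andP: gammaL.
have mgc := measurable_grad_conj _ phi_ref.
have mphi := continuous_measurable_borel_rV phi
  (reference_function_continuous _ phi_ref).
have mf : measurable_fun setT (f : borel_rV R n -> R).
  apply: continuous_measurable_borel_rV => z.
  by apply: differentiable_continuous; case: f1.
have mgrad : measurable_fun setT (grad f : borel_rV R n -> borel_rV R n).
  apply: measurable_borel_rV => i; apply: continuous_measurable_borel_rV => z.
  case: f1 => _ cgrad.
  exact: (cvg_comp _ _ (cgrad z) (@coord_continuous R 1 n 0 i (grad f z))).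
have mg k : measurable_fun setT (g k) by exact: measurable_funPT.
(* Only the [g k] are given as random variables; measurability of the iterates follows through the
   recursion. *)
have mx k : measurable_fun setT (x k).
  elim: k => [|k IHk]; first by rewrite (funext x0E); exact: measurable_cst.
  rewrite (funext (xS k)); apply: measurable_borel_rVB => //.
  by apply: measurable_borel_rVZ; apply: measurableT_comp.
pose err z v := phi (grad_conj phi (grad f z) - grad_conj phi v).
have merr : measurable_fun setT
    (fun zv : borel_rV R n * borel_rV R n => (err zv.1 zv.2)%:E).
  apply/measurable_EFinP; rewrite /err.
  apply: (measurableT_comp mphi); apply: measurable_borel_rVB.
    apply: (measurableT_comp mgc); apply: (measurableT_comp mgrad).
    exact: measurable_fst.
  apply: (measurableT_comp mgc); exact: measurable_snd.
have merrk k : measurable_fun setT (fun w => (err (x k w) (g k w))%:E).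
  apply: (measurableT_comp (g := fun w => (x k w, g k w)) merr).
  exact: measurable_fun_pair.
have moracle : measurable_fun setT
    (fun z => \int[oracle z]_v (err z v)%:E)%E.
  apply: (measurable_fun_integral_finite_kernel _ oracle _ merr) => zv.
  by rewrite lee_fin phi_ge0.
have err_le k : (\int[P]_w (err (x k w) (g k w))%:E <= (sigma ^+ 2)%:E)%E.
  rewrite (conditional_law_integral P (x k) (g k) oracle (mx k) (mg k)
    _ (xgK k) merr)/=; last by move=> zv; rewrite lee_fin phi_ge0.
  apply: (@le_trans _ _ (\int[P]_w (sigma ^+ 2)%:E)%E); last first.
    by rewrite integral_cst// [X in (_ * X)%E]probability_setT mule1.
  apply: ge0_le_integral => //.
  - by move=> w _; apply: integral_ge0 => v _; rewrite lee_fin phi_ge0.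
  - exact: (measurableT_comp moracle (mx k)).
have step z v :
    f (z - gamma *: grad_conj phi v) - fs <=
    (1 - gamma * mu) * (f z - fs) + gamma * err z v.
  have := anisotropic_descent _ phi_ref f L gamma z (grad_conj phi v)
    L0 gammaL f_smooth.
  have := f_dom z; rewrite -/fs -(ler_pM2l gamma0) /err /=; lra.
move=> k; rewrite unlock.
(* Splitting the integral and applying the induction hypothesis both require a nonnegative factor
   [1 - gamma * mu]. *)
have [rate_ge0|rate_lt0] := leP 0 (1 - gamma * mu); last first.
  (* The noiseless step [v = u] cannot go below [inf f], so [f] is constant. *)
  have f0 z : f z - fs = 0.
    apply/eqP; rewrite eq_le f_ge andbT.
    have := step z (grad f z); rewrite /err subrr.
    have -> : phi 0 = 0 by case: phi_ref.
    have := f_ge (z - gamma *: grad_conj phi (grad f z)); nra.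
  under eq_integral do rewrite f0.
  rewrite integral0 lee_fin f0 mulr0 add0r.
  by rewrite divr_ge0 ?sqr_ge0// ltW.
elim: k => [|k IHk].
  under eq_integral do rewrite x0E.
  rewrite integral_cst// [X in (_ * X)%E]probability_setT mule1 lee_fin.
  by rewrite expr0 mul1r lerDl divr_ge0 ?sqr_ge0// ltW.
have mfk j : measurable_fun setT (fun w => (f (x j w) - fs)%:E).
  apply/measurable_EFinP; apply: measurable_funB; last exact: measurable_cst.
  exact: measurableT_comp.
apply: (@le_trans _ _ (\int[P]_w ((1 - gamma * mu)%:E * (f (x k w) - fs)%:E +
    gamma%:E * (err (x k w) (g k w))%:E))%E).
  apply: ge0_le_integral => //.
  - by move=> w _; rewrite lee_fin f_ge.
  - by apply: emeasurable_funD; apply: measurable_funeM.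
  - by move=> w _; rewrite -!EFinM -EFinD lee_fin xS step.
rewrite ge0_integralD//; first last.
- exact: measurable_funeM.
- by move=> w _; rewrite mule_ge0// lee_fin ?phi_ge0// ltW.
- exact: measurable_funeM.
- by move=> w _; rewrite mule_ge0// lee_fin.
rewrite !ge0_integralZl//; first last.
- by move=> w _; rewrite lee_fin.
- by rewrite lee_fin ltW.
- by move=> w _; rewrite lee_fin phi_ge0.
apply: (@le_trans _ _ ((1 - gamma * mu)%:E *
    ((1 - gamma * mu) ^+ k * (f x0 - fs) + sigma ^+ 2 / mu)%:E +
    gamma%:E * (sigma ^+ 2)%:E)%E).
  by apply: leeD; apply: lee_wpmul2l => //; rewrite lee_fin ?ltW.
(* Equality holds because [sigma ^+ 2 / mu] is the fixed point of [s |-> (1 - gamma * mu) * s +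
   gamma * sigma ^+ 2]. *)
rewrite -!EFinM -EFinD lee_fin (exprS _ k) le_eqVlt; apply/orP; left; apply/eqP.
by field; rewrite gt_eqF.
Qed.
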